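(* Let $k\ge1$ be an integer, $\lambda>0$, $0<\alpha\le2$, and $\theta\in\mathbf{R}$ with $|\theta|\le\min(\pi\alpha/2,\ \pi-\pi\alpha/2)$. Then the generalized Linnik law GL$(\alpha,\theta,1/k)$, i.e. the probability law on $\mathbf{R}$ with characteristic function $$\phi(u)=\frac{1}{\left[1+\lambda|u|^{\alpha}e^{-i\theta\,\mathrm{sgn}(u)}\right]^{1/k}},\qquad u\in\mathbf{R},$$ belongs to class-L.
   Context: A probability law on $\mathbf{R}$ with characteristic function $\phi$ belongs to class-L (is self-decomposable) if for every $c\in(0,1)$ there is a characteristic function $\phi_c$ with $\phi(u)=\phi(cu)\,\phi_c(u)$ for all $u\in\mathbf{R}$. The root is the principal branch. It is known that the displayed function is a characteristic function for the stated parameters. *)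

(* Defs.v *)
From mathcomp Require Import all_boot all_order all_algebra.
From mathcomp Require Import all_classical all_reals all_analysis.
From mathcomp Require Import complex.

Set Implicit Arguments.
Unset Strict Implicit.
Unset Printing Implicit Defensive.

Import Order.TTheory GRing.Theory Num.Theory.
Import numFieldNormedType.Exports.

Local Open Scope ring_scope.
Local Open Scope complex_scope.

(* [e^(it)] for real [t]. *)
Definition expi (R : realType) (t : R) : R[i] := cos t +i* sin t.

(* Principal argument, with values in ]-pi, pi]; the value at [z = 0] is
   irrelevant. *)
Definition Arg (R : realType) (z : R[i]) : R :=
  let t := acos (complex.Re z / Normc.normc z) in
  if 0 <= complex.Im z then t else - t.

(* Principal branch of [z ^ a], i.e. [exp (a * Log z)], for real [a]. *)
Definition cpowR (R : realType) (z : R[i]) (a : R) : R[i] :=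
  (Normc.normc z `^ a)%:C * expi (a * Arg z).

(* The integral of the bounded complex function [x |-> e^(iux)] is taken
   componentwise. *)
Definition charfun (R : realType) (mu : probability (measurableTypeR R) R)
    (u : R) : R[i] :=
  (\int[mu]_x cos (u * x))%R +i* (\int[mu]_x sin (u * x))%R.

Definition is_charfun (R : realType) (f : R -> R[i]) : Prop :=
  exists mu : probability (measurableTypeR R) R, forall u, charfun mu u = f u.

Definition class_L (R : realType) (mu : probability (measurableTypeR R) R) :
    Prop :=
  forall c : R, 0 < c -> c < 1 ->
    exists2 phi_c : R -> R[i], is_charfun phi_c &
      forall u : R, charfun mu u = charfun mu (c * u) * phi_c u.

Definition GL_phi (R : realType) (lambda alpha theta nu u : R) : R[i] :=
  1 / cpowR (1 + (lambda * `|u| `^ alpha)%:C * expi (- (theta * Num.sg u))) nu.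

(* Main.v *)
(** Put [b = c^alpha], [q = 1 - b] and [h(u) = phi(cu)^k = 1 / (1 + b z(u))],
    where [phi(u)^k = 1 / (1 + z(u))].  Then [(phi(u) / phi(cu))^k] equals
    [b / (1 - q h(u))], so the candidate for [phi_c] is the root
    [b^(1/k) (1 - q h)^(-1/k)].  The Taylor coefficients of [(1 - x)^(-1/k)]
    are nonnegative, hence this root is a mixture of the characteristic
    functions [h^n]: a compound negative binomial law.  Finally
    [phi(cu) phi_c(u)] and [phi(u)] are characteristic functions with the same
    [k]-th power and without zeros, and a continuity argument shows that they
    coincide. *)

Require Import Defs.
From HB Require Import structures.
From mathcomp Require Import all_boot all_order all_algebra.
From mathcomp Require Import all_classical all_reals all_analysis.
From mathcomp Require Import complex.
From mathcomp Require Import ring lra.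

Import Order.TTheory GRing.Theory Num.Theory.
Import numFieldNormedType.Exports.

Local Open Scope ring_scope.

(** * Bounded functions under a probability measure *)

Section bounded_integrals.
Context d (T : measurableType d) (R : realType).
Implicit Types (P : probability T R) (f : T -> R).
Local Open Scope classical_set_scope.

Lemma probability_integrable P f (M : R) : measurable_fun setT f ->
  (forall x, `|f x| <= M) -> P.-integrable setT (EFin \o f).
Proof.
move=> mf fM; apply: measurable_bounded_integrable => //.
  by rewrite [ltLHS]probability_setT ltry.
exists M; split; first exact: num_real.
by move=> N MN x _; apply: le_trans (fM x) (ltW MN).
Qed.

End bounded_integrals.

(** * Countable mixtures of probability laws *)

Section mixture.
Context d (T : measurableType d) (R : realType).
Local Open Scope classical_set_scope.
Variables (w : nat -> {nonneg R}) (m : nat -> probability T R).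
Hypothesis w1 : (fun n => \sum_(0 <= i < n) (w i)%:num)%R @ \oo --> (1 : R).

Definition mixture := mseries (fun n => mscale (w n) (m n)) 0.

HB.instance Definition _ := Measure.on mixture.

Let mixture_setT : mixture setT = 1%E.
Proof.
rewrite /mixture /mseries; apply/cvg_lim => //=.
rewrite (_ : (fun n => _) = EFin \o (fun n => \sum_(0 <= i < n) (w i)%:num)).
  exact: cvg_comp w1 _.
apply/funext => n /=; rewrite -sumEFin; apply: eq_bigr => i _.
by rewrite /mscale [X in (_ * X)%E](probability_setT (m i)) mule1.
Qed.

HB.instance Definition _ := Measure_isProbability.Build _ _ _ mixture mixture_setT.

Definition mixture_probability : probability T R := mixture.

(** Integration against a series of measures is termwise for nonnegative functions, so [f] is
    shifted to [f + M]. The shift adds [M] times the partial sums of the weights, which tend to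
    1. *)
Lemma mixture_Rintegral_cvg (f : T -> R) (M : R) : measurable_fun setT f ->
  (forall x, `|f x| <= M) ->
  (fun n => \sum_(0 <= i < n) (w i)%:num * \int[m i]_x f x)%R @ \oo -->
  (\int[mixture_probability]_x f x)%R.
Proof.
move=> mf fM.
have fi (P : probability T R) : P.-integrable setT (EFin \o f).
  exact: probability_integrable mf fM.
have Mi (P : probability T R) : P.-integrable setT (EFin \o cst M).
  by apply: (@probability_integrable _ _ _ P (cst M) `|M|).
have mg : measurable_fun setT (fun x => f x + M) by exact: measurable_realfun.measurable_funD.
have g0 x : 0 <= f x + M.
  by have := fM x; rewrite ler_norml => /andP[]; lra.
have gi (P : probability T R) : P.-integrable setT (EFin \o (fun x => f x + M)).
  by have := integrableD measurableT (fi P) (Mi P).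
have gE (P : probability T R) : \int[P]_x (f x + M) = (\int[P]_x f x) + M :> R.
  rewrite RintegralD//; [|exact: fi|exact: Mi].
  congr (_ + _); rewrite Rintegral_cst//.
  by rewrite [X in fine X](probability_setT P) mulr1.
suff gcvg : (fun n => \sum_(0 <= i < n) (w i)%:num * \int[m i]_x (f x + M))%R
    @ \oo --> (\int[mixture_probability]_x (f x + M))%R.
  rewrite gE in gcvg.
  rewrite (_ : (fun n => _) = (fun n => \sum_(0 <= i < n) (w i)%:num * \int[m i]_x (f x + M))%R
     \- (fun n => (\sum_(0 <= i < n) (w i)%:num) * M)); last first.
    apply/funext => n /=; rewrite mulr_suml -sumrB; apply: eq_bigr => i _.
    by rewrite gE mulrDr addrK.
  have w1M : (fun n => (\sum_(0 <= i < n) (w i)%:num) * M) @ \oo --> M.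
    by rewrite -[X in _ --> X]mul1r; exact: cvgMr_tmp w1.
  by have := cvgB gcvg w1M; rewrite addrK; exact.
pose u i := ((w i)%:num * \int[m i]_x (f x + M)%R)%:E.
rewrite (_ : (fun n => _) = fine \o (fun n => \sum_(0 <= i < n) u i)%E); last first.
  by apply/funext => n /=; rewrite sumEFin.
apply: fine_cvg; rewrite fineK; last exact: integrable_fin_num (gi _).
rewrite ge0_integral_measure_series//; last 2 first.
- by move=> x _; rewrite lee_fin.
- exact/measurable_realfun.measurable_EFinP.
rewrite (eq_eseriesr (g := u)); last first.
  move=> i _; rewrite ge0_integral_mscale//; last 2 first.
  - exact/measurable_realfun.measurable_EFinP.
  - by move=> x _; rewrite lee_fin.
  by rewrite /u EFinM fineK//; exact: integrable_fin_num (gi _).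
apply: is_cvg_nneseries => n _ _.
by rewrite lee_fin mulr_ge0// Rintegral_ge0.
Qed.


End mixture.

(** * Closure properties of characteristic functions *)

Section characteristic_functions.
Variable R : realType.
Implicit Types (f g : R -> R[i]) (mu : probability (measurableTypeR R) R).
Local Open Scope classical_set_scope.
Local Open Scope complex_scope.

Lemma measurable_cosM (u : R) :
  measurable_fun [set: measurableTypeR R] (fun x => cos (u * x) : R).
Proof.
apply: measurable_realfun.continuous_measurable_fun => x.
by apply: continuous_comp; [exact: mulrl_continuous|exact: continuous_cos].
Qed.

Lemma measurable_sinM (u : R) :
  measurable_fun [set: measurableTypeR R] (fun x => sin (u * x) : R).
Proof.
apply: measurable_realfun.continuous_measurable_fun => x.
by apply: continuous_comp; [exact: mulrl_continuous|exact: continuous_sin].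
Qed.

Lemma normr_cos_le1 (x : R) : `|cos x| <= 1.
Proof. by rewrite ler_norml cos_le1 cos_geN1. Qed.

Lemma normr_sin_le1 (x : R) : `|sin x| <= 1.
Proof. by rewrite ler_norml sin_le1 sin_geN1. Qed.

(** The witness is the image law of [X] under [P]. The closure properties below then amount to
    choosing a random variable. *)
Lemma is_charfun_RV d (T : measurableType d) (P : probability T R) (X : T -> R) :
  measurable_fun [set: T] X ->
  is_charfun (fun u => (\int[P]_x cos (u * X x)) +i* (\int[P]_x sin (u * X x))).
Proof.
move=> mX; pose Y : {mfun T >-> measurableTypeR R} :=
  @mfun_Sub _ _ T (measurableTypeR R) X (mem_set mX).
exists (distribution P Y) => u; congr (_ +i* _); congr fine.
- rewrite integral_distribution//.
    apply/measurable_realfun.measurable_EFinP;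
      exact: measurable_cosM.
  apply: (@probability_integrable _ _ _ P (fun x => cos (u * X x)) 1).
    exact: (measurableT_comp (measurable_cosM u) mX).
  by move=> x; exact: normr_cos_le1.
- rewrite integral_distribution//.
    apply/measurable_realfun.measurable_EFinP;
      exact: measurable_sinM.
  apply: (@probability_integrable _ _ _ P (fun x => sin (u * X x)) 1).
    exact: (measurableT_comp (measurable_sinM u) mX).
  by move=> x; exact: normr_sin_le1.
Qed.

Lemma is_charfun_scale f (c : R) : is_charfun f -> is_charfun (fun u => f (c * u)).
Proof.
move=> [mu muE].
have [|nu nuE] := @is_charfun_RV _ _ mu ( *%R c) => //.
exists nu => u; rewrite nuE -muE /charfun.
by congr (_ +i* _); apply: eq_Rintegral => x _; rewrite mulrCA mulrA.
Qed.

Lemma is_charfun1 : is_charfun (fun=> 1 : R[i]).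
Proof.
have [|nu nuE] := @is_charfun_RV _ _ (@dirac _ (measurableTypeR R) 0 R) (cst 0) => //.
exists nu => u; rewrite nuE.
have cstE (a : R) : \int[@dirac _ (measurableTypeR R) 0 R]_x a = a.
  by rewrite Rintegral_cst// [X in fine X](diracT R (0 : measurableTypeR R)) mulr1.
under eq_Rintegral do rewrite mulr0 cos0.
under [X in _ +i* X]eq_Rintegral do rewrite mulr0 sin0.
by rewrite !cstE.
Qed.

Lemma Rintegral12_prod (mu nu : probability (measurableTypeR R) R)
    (h : R * R -> R) :
  measurable_fun setT h -> (forall p, `|h p| <= 1) ->
  \int[(mu \x nu)%E]_p h p = \int[mu]_x \int[nu]_y h (x, y).
Proof.
move=> mh h1.
have hi : ((mu \x nu)%E).-integrable setT (EFin \o h).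
  exact: (@probability_integrable _ _ _ (mu \x nu)%E h 1).
rewrite /Rintegral -integral12_prod_meas1//; congr fine.
apply: eq_integral => x _; rewrite /fubini_F fineK//.
apply: integrable_fin_num => //.
apply: (@probability_integrable _ _ _ nu (fun y => h (x, y)) 1) => //.
exact: measurable_fun_pair2.
Qed.

(** The witness is the law of the sum of two independent variables, the coordinates on the product
    space. Fubini and the addition formulas split the integrals. *)
Lemma is_charfunM f g : is_charfun f -> is_charfun g ->
  is_charfun (fun u => f u * g u).
Proof.
move=> [mu muE] [nu nuE].
have mX : measurable_fun [set: measurableTypeR R * measurableTypeR R]
    (fun p => p.1 + p.2 : R).
  exact: measurable_realfun.measurable_funD measurable_fst measurable_snd.
have [rho rhoE] := @is_charfun_RV _ _ (mu \x nu)%E _ mX.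
exists rho => u; rewrite rhoE -muE -nuE.
have ci (P : probability (measurableTypeR R) R) :
    P.-integrable setT (EFin \o (fun x => cos (u * x))).
  exact: probability_integrable (measurable_cosM u) (fun x => normr_cos_le1 (u * x)).
have si (P : probability (measurableTypeR R) R) :
    P.-integrable setT (EFin \o (fun x => sin (u * x))).
  exact: probability_integrable (measurable_sinM u) (fun x => normr_sin_le1 (u * x)).
have -> := Rintegral12_prod mu nu _ (measurableT_comp (measurable_cosM u) mX)
  (fun p => normr_cos_le1 _).
have -> := Rintegral12_prod mu nu _ (measurableT_comp (measurable_sinM u) mX)
  (fun p => normr_sin_le1 _).
(* Used twice: on the inner integral, with coefficients depending on [x], then on the outer one,
   with the integrals over [nu] as coefficients. *)
have lin (P : probability (measurableTypeR R) R) (a b : R) :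
    \int[P]_x (a * cos (u * x) + b * sin (u * x)) =
    a * (\int[P]_x cos (u * x)) + b * (\int[P]_x sin (u * x)).
  rewrite RintegralD//; last 2 first.
  - by have := integrableZl measurableT a (ci P).
  - by have := integrableZl measurableT b (si P).
  by rewrite RintegralZl ?RintegralZl //; (exact: ci || exact: si).
rewrite /charfun /=; congr (_ +i* _).
- under eq_Rintegral => x _.
    under eq_Rintegral do rewrite mulrDr cosD -mulNr.
    rewrite lin [X in X + _]mulrC [X in _ + X]mulrC mulrN -mulNr; over.
  by rewrite lin; ring.
- under eq_Rintegral => x _.
    under eq_Rintegral do rewrite mulrDr sinD.
    rewrite lin addrC [X in X + _]mulrC [X in _ + X]mulrC; over.
  by rewrite lin; ring.
Qed.

Lemma is_charfunX f n : is_charfun f -> is_charfun (fun u => f u ^+ n).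
Proof.
move=> fc; elim: n => [|n IHn]; first exact: is_charfun1.
have [nu nuE] := is_charfunM _ _ fc IHn.
by exists nu => u; rewrite nuE exprS.
Qed.

End characteristic_functions.

(** * Convergence of complex sequences *)

Section complex_sequences.
Variable R : realType.
Implicit Types (x y z : nat -> R[i]) (a b : R[i]).
Local Open Scope classical_set_scope.
Local Open Scope complex_scope.

(** Componentwise, like [charfun], so that real limit theorems apply to each part. *)
Definition cvgC z a :=
  (complex.Re (z n) @[n --> \oo] --> complex.Re a) /\
  (complex.Im (z n) @[n --> \oo] --> complex.Im a).

Lemma cvgC_cst a : cvgC (fun=> a) a.
Proof. by split; exact: cvg_cst. Qed.

Lemma cvgC_unique z a b : cvgC z a -> cvgC z b -> a = b.
Proof.
case: a b => [a1 a2] [b1 b2] [/= za1 za2] [/= zb1 zb2].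
by congr (_ +i* _); [exact: cvg_unique za1 zb1|exact: cvg_unique za2 zb2].
Qed.

Lemma ReM a b : complex.Re (a * b) =
  complex.Re a * complex.Re b - complex.Im a * complex.Im b.
Proof. by case: a b => [? ?] [? ?]. Qed.

Lemma ImM a b : complex.Im (a * b) =
  complex.Re a * complex.Im b + complex.Im a * complex.Re b.
Proof. by case: a b => [? ?] [? ?]. Qed.

Lemma cvgCM x y a b : cvgC x a -> cvgC y b -> cvgC (fun n => x n * y n) (a * b).
Proof.
move=> [xa1 xa2] [yb1 yb2]; split.
  under eq_fun do rewrite ReM; rewrite ReM.
  exact: cvgB (cvgM xa1 yb1) (cvgM xa2 yb2).
under eq_fun do rewrite ImM; rewrite ImM.
exact: cvgD (cvgM xa1 yb2) (cvgM xa2 yb1).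
Qed.

Lemma cvgCX x a k : cvgC x a -> cvgC (fun n => x n ^+ k) (a ^+ k).
Proof.
move=> xa; elim: k => [|k IHk]; first exact: cvgC_cst.
by rewrite exprS; under eq_fun do rewrite exprS; exact: cvgCM.
Qed.

Lemma cvgC_squeeze z a (e : nat -> R) : (forall n, `|z n - a| <= (e n)%:C) ->
  e n @[n --> \oo] --> (0 : R) -> cvgC z a.
Proof.
have cvg_dist (t : nat -> R) l : (forall n, `|t n - l| <= e n) ->
    e n @[n --> \oo] --> (0 : R) -> t n @[n --> \oo] --> l.
  move=> te e0; apply/cvgrPdist_le => eps eps0.
  move/cvgrPdist_le : e0 => /(_ _ eps0); apply: filterS => n.
  by rewrite sub0r normrN distrC => en; rewrite (le_trans (te n))// (le_trans (ler_norm _)).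
move=> ze e0; split; apply: cvg_dist => // n; rewrite -raddfB.
  by rewrite -lecR (le_trans (normc_ge_Re _)).
rewrite -lecR (le_trans _ (ze n))// normc_def lecR -[leLHS]sqrtr_sqr.
by rewrite ler_sqrt// ?lerDr ?sqr_ge0// addr_ge0 ?sqr_ge0.
Qed.

End complex_sequences.

Arguments cvgC {R}.

(** * Mixtures and continuity of characteristic functions *)

Section charfun_limits.
Variable R : realType.
Implicit Types mu : probability (measurableTypeR R) R.
Local Open Scope classical_set_scope.
Local Open Scope complex_scope.

Lemma is_charfun_mixture (w : nat -> {nonneg R}) (f : nat -> R -> R[i]) :
  (\sum_(0 <= i < n) (w i)%:num @[n --> \oo] --> (1 : R)) ->
  (forall n, is_charfun (f n)) ->
  exists2 g, is_charfun g &
    forall u, cvgC (fun n => \sum_(0 <= i < n) ((w i)%:num)%:C * f i u) (g u).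
Proof.
move=> w1 /choice[m mf]; exists (charfun (mixture_probability _ _ _ w m w1)); first by eexists.
move=> u.
have fE i : ((w i)%:num)%:C * f i u =
    ((w i)%:num * \int[m i]_x cos (u * x)) +i* ((w i)%:num * \int[m i]_x sin (u * x)).
  by rewrite -mf /charfun; simpc.
split.
- rewrite (_ : (fun n => _) =
      (fun n => \sum_(0 <= i < n) (w i)%:num * \int[m i]_x cos (u * x))).
    apply: mixture_Rintegral_cvg (measurable_cosM R u) _ => x.
    exact: (normr_cos_le1 R (u * x)).
  apply/funext => n; rewrite [complex.Re _]raddf_sum; apply: eq_bigr => i _.
  by rewrite fE.
- rewrite (_ : (fun n => _) =
      (fun n => \sum_(0 <= i < n) (w i)%:num * \int[m i]_x sin (u * x))).
    apply: mixture_Rintegral_cvg (measurable_sinM R u) _ => x.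
    exact: (normr_sin_le1 R (u * x)).
  apply/funext => n; rewrite [complex.Im _]raddf_sum; apply: eq_bigr => i _.
  by rewrite fE.
Qed.

(** Dominated convergence on an interval around [a]; the constant 1 dominates and is integrable
    because [mu] is a probability. *)
Lemma continuous_Rintegral_bounded mu (h : R -> R) :
  continuous h -> (forall x, `|h x| <= 1) ->
  continuous (fun u : R => \int[mu]_x h (u * x) : R).
Proof.
move=> ch h1 a.
have mh u : measurable_fun [set: measurableTypeR R] (fun x => h (u * x)).
  apply: measurable_realfun.continuous_measurable_fun => x.
  by apply: continuous_comp; [exact: mulrl_continuous|exact: ch].
apply: (@continuity_under_integral _ _ _ mu (fun u x => h (u * x)) setT
  measurableT (a - 1) (a + 1) _ _ (fun=> 1)).
- move=> u _; exact: probability_integrable (mh u) (fun x => h1 (u * x)).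
- apply: aeW => y _ u _.
  by apply: continuous_comp; [exact: mulrr_continuous|exact: ch].
- by apply: (@probability_integrable _ _ _ mu (fun=> 1) 1) => // x; rewrite normr1.
- by move=> u _; apply: aeW => y _.
- by rewrite inE/= in_itv/= ltrBlDr !ltrDl ltr01.
Qed.

Lemma continuous_Re_charfun mu : continuous (fun u : R => complex.Re (charfun mu u)).
Proof.
exact: continuous_Rintegral_bounded (@continuous_cos R) (normr_cos_le1 R).
Qed.

Lemma continuous_Im_charfun mu : continuous (fun u : R => complex.Im (charfun mu u)).
Proof.
exact: continuous_Rintegral_bounded (@continuous_sin R) (normr_sin_le1 R).
Qed.

Lemma charfun0 mu : charfun mu 0 = 1.
Proof.
rewrite /charfun.
under eq_Rintegral do rewrite mul0r cos0.
under [X in _ +i* X]eq_Rintegral do rewrite mul0r sin0.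
by rewrite !Rintegral_cst// mul0r mul1r [X in fine X](probability_setT mu).
Qed.

End charfun_limits.

(** * Truncated Taylor series of $(1-x)^{-1/k}$ *)

Section root_series.
Variables (F : numFieldType) (k : nat).
Hypothesis k_gt0 : (0 < k)%N.

(* The Taylor coefficients of [(1 - x)^(-1/k)]. *)
Definition root_coef (n : nat) : F :=
  \prod_(j < n) ((k%:R^-1 + j%:R) / j.+1%:R).

Definition root_poly (N : nat) : {poly F} := \poly_(i < N.+1) root_coef i.

Lemma root_coef_ge0 n : 0 <= root_coef n.
Proof.
by apply: prodr_ge0 => j _; rewrite divr_ge0 ?addr_ge0 ?invr_ge0 ?ler0n.
Qed.

Lemma root_coefS n :
  k%:R * (n.+1%:R * root_coef n.+1) = (1 + k%:R * n%:R) * root_coef n.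
Proof.
have k0 : k%:R != 0 :> F by rewrite pnatr_eq0 -lt0n.
have n0 : n.+1%:R != 0 :> F by rewrite pnatr_eq0.
rewrite /root_coef big_ord_recr /=.
by field; rewrite k0 nat1r n0.
Qed.

Lemma horner_root_poly N x :
  (root_poly N).[x] = \sum_(0 <= i < N.+1) root_coef i * x ^+ i.
Proof. by rewrite horner_poly big_mkord. Qed.

(* The truncated solution of the differential equation
   [k (1 - x) y' = y] satisfied by [(1 - x)^(-1/k)]. *)
Lemma root_poly_ode N :
  k%:R *: ((1 - 'X) * (root_poly N)^`()) =
  root_poly N - ((1 + k%:R * N%:R) * root_coef N) *: 'X^N.
Proof.
apply/polyP => i; rewrite mulrBl mul1r coefZ !coefB coefXM !coef_deriv.
rewrite coefZ coefXn !coef_poly.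
(* The coefficient of $x y'$ is put in a form that also covers [i = 0]. Below [N] the recursion
   applies, above [N] all terms vanish, and at [N] the truncation leaves the error term. *)
rewrite [X in _ * (_ - X)](_ : _ = (if (i < N.+1)%N then root_coef i else 0) *+ i);
  last by case: i.
rewrite !ltnS; case: (ltngtP i N) => [iN|Ni|->].
- by rewrite mulr0 subr0 mulrBr -!(mulr_natl (root_coef _)) root_coefS; ring.
- by rewrite !mul0rn subrr !mulr0 subr0.
- by rewrite mul0rn -(mulr_natl (root_coef _)) /=; ring.
Qed.

(** With $y$ the truncation, the derivative of $1-y^k(1-x)$ is $y^{k-1}(y-k(1-x)y')$, and the
    differential equation reduces the second factor to its truncation error. *)
Lemma root_poly_deriv N :
  (1 - root_poly N ^+ k * (1 - 'X))^`() =
  ((1 + k%:R * N%:R) * root_coef N) *: ('X^N * root_poly N ^+ k.-1).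
Proof.
have ode := root_poly_ode N.
rewrite derivB derivC sub0r derivM derivB derivC derivX sub0r deriv_exp mulrN1.
have -> : root_poly N ^+ k = root_poly N * root_poly N ^+ k.-1.
  by rewrite -exprS prednK.
have -> : (root_poly N)^`() * root_poly N ^+ k.-1 *+ k * (1 - 'X) =
   (k%:R *: ((1 - 'X) * (root_poly N)^`())) * root_poly N ^+ k.-1.
  by rewrite -!mul_polyC polyC_natr -mulr_natl; ring.
by rewrite ode -!mul_polyC; ring.
Qed.

(** The truncation takes the value 1 at 0, which settles the constant term; the derivative is
    divisible by ['X^N], which settles the others. *)
Lemma root_poly_rem_coef0 N i : (i <= N)%N ->
  (1 - root_poly N ^+ k * (1 - 'X))`_i = 0.
Proof.
case: i => [_|i iN].
  rewrite -horner_coef0 !hornerE horner_root_poly big_nat_recl//.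
  rewrite /root_coef big_ord0 expr0 mulr1 big1 => [|j _].
    by rewrite addr0 expr1n subr0 mulr1 subrr.
  by rewrite expr0n mulr0.
have := coef_deriv (1 - root_poly N ^+ k * (1 - 'X)) i.
rewrite root_poly_deriv coefZ coefXnM iN mulr0 => /esym/eqP.
by rewrite mulrn_eq0 => /eqP.
Qed.

Lemma root_poly_rem_coef_ge0 N i :
  0 <= (1 - root_poly N ^+ k * (1 - 'X))`_i.
Proof.
case: i => [|i]; first by rewrite root_poly_rem_coef0.
have := coef_deriv (1 - root_poly N ^+ k * (1 - 'X)) i.
rewrite root_poly_deriv coefZ coefXnM => E.
rewrite -(pmulrn_lge0 _ (ltn0Sn i)) -E.
rewrite mulr_ge0 ?mulr_ge0 ?root_coef_ge0 ?addr_ge0 ?mulr_ge0 ?ler0n//.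
case: ifP => // _.
(* Powers of a polynomial with nonnegative coefficients have nonnegative coefficients. *)
elim: (k.-1) (i - N)%N => [|n IHn] j; first by rewrite expr0 coef1 ler0n.
rewrite exprS coefM; apply: sumr_ge0 => l _; apply: mulr_ge0 => //.
by rewrite coef_poly; case: ifP => // _; exact: root_coef_ge0.
Qed.

(** The remainder has nonnegative coefficients, only in degrees above [N], and they sum to its value
    1 at $x=1$. The estimate serves over both [R] and [R[i]]. *)
Lemma root_poly_exp N (x : F) : `|x| <= 1 ->
  `|1 - (root_poly N).[x] ^+ k * (1 - x)| <= `|x| ^+ N.
Proof.
move=> x1; set E := 1 - root_poly N ^+ k * (1 - 'X).
have hE y : E.[y] = 1 - (root_poly N).[y] ^+ k * (1 - y).
  by rewrite /E !hornerE.
have E1 : \sum_(i < size E) E`_i = 1.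
  transitivity E.[1]; last by rewrite hE subrr mulr0 subr0.
  by rewrite horner_coef; apply: eq_bigr => i _; rewrite expr1n mulr1.
rewrite -hE horner_coef (le_trans (ler_norm_sum _ _ _))//.
rewrite -[leRHS]mul1r -E1 mulr_suml; apply: ler_sum => i _.
rewrite normrM normrX ger0_norm ?root_poly_rem_coef_ge0//.
have [iN|Ni] := leqP i N; first by rewrite [E`_i]root_poly_rem_coef0 ?mul0r.
apply: ler_wpM2l; first exact: root_poly_rem_coef_ge0.
by apply: ler_wiXn2l => //; exact: ltnW.
Qed.

End root_series.

(** * Compound negative binomial laws *)

Section compound.
Variables (R : realType) (k : nat) (q : R).
Hypotheses (k_gt0 : (0 < k)%N) (q_ge0 : 0 <= q) (q_lt1 : q < 1).
Local Open Scope classical_set_scope.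
Local Open Scope complex_scope.

Let s n : R := \sum_(0 <= i < n) root_coef R k i * q ^+ i.

Let term_ge0 i : 0 <= root_coef R k i * q ^+ i.
Proof. by rewrite mulr_ge0 ?root_coef_ge0 ?exprn_ge0. Qed.

Let s_nd : nondecreasing_seq s.
Proof.
by apply/nondecreasing_seqP => n; rewrite /s big_nat_recr//= lerDl.
Qed.

Let s_ge1 n : 1 <= s n.+1.
Proof.
rewrite /s big_nat_recl// /root_coef big_ord0 expr0 mulr1 lerDl.
by apply: sumr_ge0 => i _; exact: term_ge0.
Qed.

(** Since [s n.+1] is at least 1, it is at most its [k]-th power, and [root_poly_exp] bounds that
    power times $1-q$ by $1+q^n\le 2$. *)
Let s_le n : s n <= 2 / (1 - q).
Proof.
apply: (le_trans (s_nd n n.+1 (leqnSn n))).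
apply: (@le_trans _ _ (s n.+1 ^+ k)); first exact: ler_eXnr.
rewrite ler_pdivlMr ?subr_gt0// /s -horner_root_poly.
have q1 : `|q| <= 1 by rewrite ger0_norm// ltW.
have := root_poly_exp R k k_gt0 n q q1.
rewrite ler_distlC => /andP[_ /le_trans -> //].
by rewrite [leRHS](_ : _ = 1 + 1)// lerD2l exprn_ile1.
Qed.

Let S := limn s.

Let s_cvg : s @ \oo --> S.
Proof.
apply: nondecreasing_is_cvgn => //.
by exists (2 / (1 - q)) => _ [n _ <-].
Qed.

Let S_gt0 : 0 < S.
Proof.
apply: (lt_le_trans ltr01); apply: (le_trans (s_ge1 0)).
by apply: (nondecreasing_cvgn_le s_nd); apply/cvg_ex; exists S.
Qed.

Let w_ge0 i : 0 <= S^-1 * (root_coef R k i * q ^+ i).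
Proof. by rewrite mulr_ge0// invr_ge0 ltW. Qed.

(** Negative binomial weights of shape $1/k$, normalised by the limit [S], whose closed form
    $(1-q)^{-1/k}$ is never computed. *)
Let w i : {nonneg R} := NngNum (w_ge0 i).

Let w_cvg : \sum_(0 <= i < n) (w i)%:num @[n --> \oo] --> (1 : R).
Proof.
rewrite (_ : (fun n => _) = (fun n => S^-1 * s n)); last first.
  by apply/funext => n; rewrite mulr_sumr.
by rewrite -(mulVf (lt0r_neq0 S_gt0)); exact: cvgMl_tmp s_cvg.
Qed.

Let root_coefC i : root_coef R[i] k i = (root_coef R k i)%:C.
Proof.
rewrite /root_coef rmorph_prod; apply: eq_bigr => j _.
by rewrite rmorphM rmorphD !fmorphV !rmorph_nat.
Qed.

(** The mixture of the powers of [h] with weights [w] is $S^{-1}$ times the Taylor series of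
    $(1-x)^{-1/k}$ at $x=qh$. *)
Lemma charfun_negbin_compound (h : R -> R[i]) : is_charfun h ->
  (forall u, `|h u| <= 1) ->
  exists2 g, is_charfun g & forall u, g u ^+ k * (1 - q%:C * h u) = (1 - q)%:C.
Proof.
move=> hc h1.
have [g gc gE] := is_charfun_mixture _ _ _ w_cvg (fun n => is_charfunX R h n hc).
have key u : g u ^+ k * (1 - q%:C * h u) = (S^-1 ^+ k)%:C.
  pose P n := (root_poly R[i] k n).[q%:C * h u].
  have wP n : \sum_(0 <= i < n.+1) ((w i)%:num)%:C * h u ^+ i = (S^-1)%:C * P n.
    rewrite /P horner_root_poly mulr_sumr; apply: eq_bigr => i _.
    by rewrite root_coefC exprMn !rmorphM rmorphXn /= !mulrA.
  have gP : cvgC (fun n => (S^-1)%:C * P n) (g u).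
    have [gR gI] := gE u; split.
      by move: gR; rewrite -cvg_shiftS; under eq_fun do rewrite wP.
    by move: gI; rewrite -cvg_shiftS; under eq_fun do rewrite wP.
  (* The error at order [n] is at most $|qh|^n\le q^n$, which tends to 0. *)
  have P1 : cvgC (fun n => P n ^+ k * (1 - q%:C * h u)) 1.
    apply: (@cvgC_squeeze _ _ _ (fun n => q ^+ n)); last first.
      by apply: cvg_expr; rewrite ger0_norm.
    move=> n; rewrite distrC.
    have qh : `|q%:C * h u| <= q%:C.
      by rewrite normrM ger0_norm ?ler0c// ler_piMr ?ler0c.
    apply: (le_trans (root_poly_exp _ k k_gt0 n _ _)).
      by rewrite (le_trans qh)// lecR ltW.
    by rewrite rmorphXn; apply: lerXn2r; rewrite ?nnegrE ?normr_ge0 ?ler0c.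
  apply: (cvgC_unique R); first exact: cvgCM (cvgCX _ _ _ k gP) (cvgC_cst _ _).
  rewrite -[X in cvgC _ X]mulr1 rmorphXn.
  under eq_fun do rewrite exprMn -mulrA.
  exact: cvgCM (cvgC_cst _ _) P1.
(* The product does not depend on [u]; at 0, where [g] and [h] equal 1, it is $1-q$. *)
exists g => // u; rewrite key -(key 0).
have charfun_at0 f : is_charfun f -> f 0 = 1 :> R[i].
  by move=> [mu <-]; exact: charfun0.
by rewrite !charfun_at0// expr1n mulr1 mul1r rmorphB.
Qed.

End compound.

(** * Uniqueness of continuous [k]-th roots *)

Section charfun_root_unique.
Variable R : realType.
Implicit Types mu nu : probability (measurableTypeR R) R.
Local Open Scope classical_set_scope.
Local Open Scope complex_scope.

(** A root of unity lies on the unit circle, which meets the half-plane of real part at least 1 only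
    at 1. *)
Lemma expr1_Re_le1 (k : nat) (z : R[i]) : (0 < k)%N -> z ^+ k = 1 ->
  complex.Re z <= 1 ?= iff (z == 1).
Proof.
move=> k0 zk1.
have z1 : `|z| = 1.
  by apply/eqP; rewrite -(@pexpr_eq1 _ _ k)// -normrX zk1 normr1.
have /(congr1 (@complex.Re R))/= : ((complex.Re z) ^+ 2 + (complex.Im z) ^+ 2)%:C = 1.
  by rewrite add_Re2_Im2 z1 expr1n.
case: z {zk1 z1} => a b /= ab; split.
  by have := sqr_ge0 b; nra.
rewrite eq_complex /=; apply/eqP/andP => [a1|[/eqP]//].
split; first by apply/eqP.
by rewrite -sqrf_eq0; apply/eqP; nra.
Qed.

(* The real part of the quotient of two continuous k-th roots is a continuous
   function of a real variable with at most k values, hence constant. *)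
Lemma charfun_root_unique (k : nat) mu nu : (0 < k)%N ->
  (forall u, charfun nu u != 0) ->
  (forall u, charfun mu u ^+ k = charfun nu u ^+ k) ->
  forall u, charfun mu u = charfun nu u.
Proof.
move=> k0 nu0 munu u.
pose z v := charfun mu v / charfun nu v.
have zk v : z v ^+ k = 1 by rewrite expr_div_n munu divff// expf_neq0.
suff z1 : z u = 1 by rewrite -[LHS](divfK (nu0 u)) -/(z u) z1 mul1r.
(* The quotient is followed along the segment from 0, where it equals 1, to [u]. *)
pose rho t := complex.Re (z (u * t)).
have rho0 : rho 0 = 1 by rewrite /rho mulr0 /z !charfun0 divr1.
have rho_cont : continuous rho.
  have comp (f : R -> R) : continuous f -> continuous (fun t : R => f (u * t)).
    by move=> cf t; apply: continuous_comp; [exact: mulrl_continuous|exact: cf].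
  pose Re1 t := complex.Re (charfun mu (u * t)).
  pose Im1 t := complex.Im (charfun mu (u * t)).
  pose Re2 t := complex.Re (charfun nu (u * t)).
  pose Im2 t := complex.Im (charfun nu (u * t)).
  have Re1c : continuous Re1 := comp _ (continuous_Re_charfun R mu).
  have Im1c : continuous Im1 := comp _ (continuous_Im_charfun R mu).
  have Re2c : continuous Re2 := comp _ (continuous_Re_charfun R nu).
  have Im2c : continuous Im2 := comp _ (continuous_Im_charfun R nu).
  have -> : rho = (fun t => (Re1 t * Re2 t + Im1 t * Im2 t) /
                            (Re2 t * Re2 t + Im2 t * Im2 t)).
    apply/funext => t; rewrite /rho /z /Re1 /Im1 /Re2 /Im2.
    case: (charfun mu _) (charfun nu _) => [a b] [c d] /=.
    by rewrite !expr2 mulrN opprK !mulrA -mulrDl.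
  move=> t; apply: cvgM.
    by apply: cvgD; apply: cvgM; [exact: Re1c|exact: Re2c|exact: Im1c|exact: Im2c].
  apply: cvgV.
    have := nu0 (u * t); rewrite /Re2 /Im2; case: (charfun nu _) => [c d].
    apply: contra => /eqP cd0; rewrite eq_complex /=.
    by rewrite -sqrf_eq0 -[d == 0]sqrf_eq0 -paddr_eq0 ?sqr_ge0// !expr2 cd0.
  by apply: cvgD; apply: cvgM; [exact: Re2c|exact: Re2c|exact: Im2c|exact: Im2c].
apply/eqP; rewrite -(expr1_Re_le1 _ _ k0 (zk u)).2; apply/negPn/negP => rho1.
have {}rho1 : rho 1 < 1 by rewrite /rho mulr1 lt_neqAle rho1 (expr1_Re_le1 _ _ k0 (zk u)).1.
(* For [i] from 0 to [k] these are $k+1$ distinct values between [rho 1] and 1. The intermediate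
   value theorem makes each the real part of a [k]-th root of unity, one root too many. *)
pose a (i : nat) := 1 - (1 - rho 1) * (i%:R / k.+1%:R).
have aP i : (i <= k)%N -> exists v, complex.Re (z v) = a i.
  move=> ik.
  have ik1 : 0 <= (i%:R / k.+1%:R : R) <= 1.
    by rewrite divr_ge0 ?ler0n//= ler_pdivrMr ?ltr0n// mul1r ler_nat ltnW.
  have [] := @IVT _ rho 0 1 (a i) ler01.
  - exact: continuous_subspaceT.
  - rewrite rho0 (min_idPr (ltW rho1)) (max_idPl (ltW rho1)) /a.
    by move: ik1 => /andP[]; set t := _ / _ => t0 t1; apply/andP; split; nra.
  - by move=> t _ rt; exists (u * t).
(* The default value 1 is itself a [k]-th root of unity, so every [r i] is one. *)
pose r i := if pselect (exists v, complex.Re (z v) = a i) is left e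
            then z (projT1 (cid e)) else 1.
have rP i : (i <= k)%N -> complex.Re (r i) = a i.
  by move=> /aP e; rewrite /r; case: pselect => // e'; case: cid.
have : (size [seq r i | i <- iota 0 k.+1] <= k)%N.
  apply: max_unity_roots => //.
  - apply/allP => _ /mapP[i _ ->]; rewrite /r unity_rootE.
    by case: pselect => e; rewrite ?zk ?expr1n.
  - rewrite map_inj_in_uniq ?iota_uniq// => i j; rewrite !mem_iota !add0n !ltnS.
    move=> /= /rP ri /rP rj rij; have : a i = a j by rewrite -ri rij.
    move/addrI/oppr_inj/mulfI => /(_ (lt0r_neq0 _)).
    rewrite subr_gt0 => /(_ rho1) /mulIf.
    by rewrite invr_eq0 pnatr_eq0 => /(_ isT)/eqP; rewrite eqr_nat => /eqP.
by rewrite size_map size_iota ltnn.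
Qed.

End charfun_root_unique.

(** * Polar form and the principal root *)

Section principal_root.
Variable R : realType.
Local Open Scope complex_scope.

Lemma expiD (s t : R) : expi (s + t) = expi s * expi t.
Proof. by rewrite /expi cosD sinD; simpc; congr (_ +i* _); rewrite addrC. Qed.

Lemma expiX (t : R) n : expi t ^+ n = expi (n%:R * t).
Proof.
elim: n => [|n IHn]; first by rewrite mul0r /expi cos0 sin0.
by rewrite exprS IHn -expiD -nat1r mulrDl mul1r.
Qed.

Lemma expi_Arg (z : R[i]) : (Normc.normc z)%:C * expi (Arg z) = z.
Proof.
case: z => x y; rewrite /Arg /expi /=.
set r := Num.sqrt _.
have r0 : 0 <= r by exact: sqrtr_ge0.
have r2 : r ^+ 2 = x ^+ 2 + y ^+ 2.
  by rewrite sqr_sqrtr// addr_ge0 ?sqr_ge0.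
have [r_eq0|r_neq0] := eqVneq r 0.
  have [-> ->] : x = 0 /\ y = 0.
    move: r2; rewrite r_eq0 expr0n /= => r2.
    have x2 := sqr_ge0 x; have y2 := sqr_ge0 y.
    by split; apply/eqP; rewrite -sqrf_eq0 eq_le sqr_ge0 andbT; lra.
  by rewrite r_eq0 mul0r.
have xr : -1 <= x / r <= 1.
  rewrite -ler_norml -(@expr_le1 _ 2)// -normrX ger0_norm ?sqr_ge0//.
  rewrite expr_div_n ler_pdivrMr ?exprn_gt0 ?lt_neqAle ?r0 1?eq_sym ?r_neq0//.
  by rewrite mul1r r2 lerDl sqr_ge0.
(* The arccosine determines the imaginary part up to sign; the case distinction in [Arg] restores
   the sign. *)
have sinE : r * sin (acos (x / r)) = `|y|.
  rewrite sin_acos// -{1}(ger0_norm r0) -sqrtr_sqr -sqrtrM ?sqr_ge0//.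
  rewrite mulrBr mulr1 expr_div_n [X in _ - X]mulrC divfK ?sqrf_eq0//.
  by rewrite r2 addrC addKr sqrtr_sqr.
have rE a b : r%:C * (a +i* b) = (r * a) +i* (r * b) by simpc.
case: ifPn => [y0|y0]; rewrite ?cosN ?sinN acosK// rE; congr (_ +i* _).
- by rewrite mulrC divfK.
- by rewrite sinE ger0_norm.
- by rewrite mulrC divfK.
- by rewrite mulrN sinE ltr0_norm ?ltNge// opprK.
Qed.

Lemma cpowRVX (z : R[i]) (k : nat) : (0 < k)%N -> cpowR z (1 / k%:R) ^+ k = z.
Proof.
move=> k0; have k0' : k%:R != 0 :> R by rewrite pnatr_eq0 -lt0n.
rewrite /cpowR exprMn expiX -rmorphXn /= -powR_mulrn ?powR_ge0// -powRrM.
rewrite mulrA mul1r mulVf// mulfV// mul1r powRr1 ?expi_Arg//.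
by case: z => x y; exact: sqrtr_ge0.
Qed.

End principal_root.

(** * Self-decomposability of the generalized Linnik law *)

Lemma theta_abs_le_pihalf (R : realType) (alpha theta : R) :
  `|theta| <= Num.min (pi * alpha / 2) (pi - pi * alpha / 2) ->
  `|theta| <= pi / 2.
(* The two bounds in the minimum average to [pi / 2]. *)
Proof. by rewrite le_min => /andP[]; lra. Qed.

Theorem theorem2p3 (R : realType) (k : nat) (lambda alpha theta : R)
    (hk : (1 <= k)%N) (hlambda : 0 < lambda)
    (halpha0 : 0 < alpha) (halpha2 : alpha <= 2)
    (htheta : `|theta| <= Num.min (pi * alpha / 2) (pi - pi * alpha / 2))
    (mu : probability (measurableTypeR R) R)
    (hmu : forall u : R,
      charfun mu u = GL_phi lambda alpha theta (1 / k%:R) u) :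
  class_L mu.
Proof.
move=> c c0 c1.
pose z u : R[i] := (lambda * `|u| `^ alpha)%:C%C * expi (- (theta * Num.sg u)).
pose b := c `^ alpha.
have b0 : 0 < b by exact: powR_gt0.
have b1 : b < 1.
  suff : b < 1 `^ alpha by rewrite powR1.
  by apply: gt0_ltr_powR; rewrite ?nnegrE ?ltW.
have zc u : z (c * u) = b%:C%C * z u.
  rewrite /z normrM (gtr0_norm c0) powRM ?(ltW c0)// sgrM (gtr0_sg c0) mul1r.
  by rewrite mulrCA -/b rmorphM mulrA.
(* The bound on [theta] keeps [z u] in the closed right half-plane; hence [phi] has no zeros and [h]
   is bounded by 1. *)
have Rez_ge0 u : 0 <= complex.Re (z u).
  rewrite /z /expi; set A := lambda * _; set B := - _.
  have -> : complex.Re (A%:C * (cos B +i* sin B))%C = A * cos B by simpc.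
  rewrite mulr_ge0 ?mulr_ge0 ?powR_ge0 ?(ltW hlambda)//.
  apply: cos_ge0_pihalf; rewrite -ler_norml normrN normrM.
  apply: le_trans (theta_abs_le_pihalf _ _ _ htheta).
  by rewrite ler_piMr// normr_sg lern1 leq_b1.
have norm_ge1 (t : R) u : 0 <= t -> 1 <= `|1 + t%:C%C * z u|.
  move=> t0; apply: le_trans (normc_ge_Re _); rewrite -[1%R]/(1%:C)%C lecR.
  apply: le_trans (ler_norm _).
  rewrite -[leLHS]/(complex.Re (1 : R[i])) raddfD lerDl.
  rewrite -[leRHS]/(complex.Re (t%:C%C * z u)) ReM.
  rewrite [X in _ - X]mul0r subr0.
  exact: mulr_ge0 t0 (Rez_ge0 u).
have neq0 (t : R) u : 0 <= t -> 1 + t%:C%C * z u != 0.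
  by move=> /norm_ge1 h; rewrite -normr_gt0 (lt_le_trans ltr01).
have z1 u : 1 + z u != 0 by have := neq0 1 u ler01; rewrite mul1r.
have muX u : charfun mu u ^+ k = (1 + z u)^-1.
  by rewrite hmu /GL_phi expr_div_n expr1n cpowRVX// div1r.
(* Being a [k]-th power, [h] is the characteristic function of a sum of [k] independent copies of
   the variable scaled by [c]. *)
pose h u := charfun mu (c * u) ^+ k.
have hE u : h u = (1 + b%:C%C * z u)^-1 by rewrite /h muX zc.
have muc : is_charfun (charfun mu) by exists mu.
have hc : is_charfun h.
  exact: is_charfunX (is_charfun_scale _ _ c muc).
have h1 u : `|h u| <= 1.
  by rewrite hE normfV invf_le1 ?norm_ge1 ?normr_gt0 ?neq0 ?ltW.
have q0 : 0 <= 1 - b by rewrite subr_ge0 ltW.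
have q1 : 1 - b < 1 by rewrite ltrBlDr ltrDl.
have [g gc gE] := charfun_negbin_compound R k (1 - b) hk q0 q1 h hc h1.
exists g => // u.
(* The product $\phi(cu)g(u)$ must come from a law for the uniqueness of roots to apply; what
   remains is to compare [k]-th powers. *)
have [nu nuE] := is_charfunM R _ _ (is_charfun_scale _ _ c muc) gc.
rewrite -nuE; symmetry; apply: (charfun_root_unique R k) => // v.
  have := invr_neq0 (z1 v); rewrite -muX; apply: contra => /eqP ->.
  by rewrite expr0n eqn0Ngt hk.
rewrite nuE exprMn -/(h v).
have D0 : 1 - (1 - b)%:C%C * h v = b%:C%C * (1 + z v) * h v.
  by rewrite hE rmorphB /=; field; exact: neq0 (ltW b0).
have bC0 : b%:C%C != 0 :> R[i] by rewrite (inj_eq (@complexI R)) lt0r_neq0.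
have := gE v; rewrite D0 subKr muX => gbE.
(* Multiplied by $b(1+z)$, both sides become $b$: the right one by cancellation, the left one by
   [gbE]. *)
apply: (mulfI (mulf_neq0 bC0 (z1 v))).
by rewrite mulfK// mulrA mulrC.
Qed.
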